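(* Let $m,n$ be positive integers and let $\mathcal{S}_{m,n}$ be the set of all continuous surjective functions $f:\mathbb{R}^m\to\mathbb{R}^n$. Then $\mathcal{S}_{m,n}$ is $\mathfrak{c}$-lineable; that is, there exists a real vector subspace $V$ of the space $\mathcal{C}(\mathbb{R}^m,\mathbb{R}^n)$ of continuous functions from $\mathbb{R}^m$ to $\mathbb{R}^n$ such that $\dim_{\mathbb{R}} V=\mathfrak{c}$ and every nonzero element of $V$ belongs to $\mathcal{S}_{m,n}$.
   Context: $\mathfrak{c}$ denotes the cardinality of $\mathbb{R}$. $\mathcal{C}(\mathbb{R}^m,\mathbb{R}^n)$ is a real vector space under pointwise operations. A set $S$ of functions contained in a real vector space is called $\mathfrak{c}$-lineable if $S\cup\{0\}$ contains a vector subspace of (Hamel) dimension $\mathfrak{c}$. Euclidean spaces carry their usual topology. *)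

(* Defs.v *)
From HB Require Import structures.
From mathcomp Require Import all_boot all_order all_algebra.
From mathcomp Require Import all_classical all_reals all_analysis.

Set Implicit Arguments.
Unset Strict Implicit.
Unset Printing Implicit Defensive.

Import Order.TTheory GRing.Theory Num.Theory.
Import numFieldNormedType.Exports.

Local Open Scope classical_set_scope.
Local Open Scope card_scope.
Local Open Scope ring_scope.

(* The library's type continuousType X Y carries no algebraic structure; when Y
   is a normed module we give it the pointwise one, as a sub-lmodType of the
   module X -> Y of all functions. *)
Section continuous_lmodule.
Context {K : numFieldType} {X : topologicalType} {Y : normedModType K}.

Definition continuous_pred : {pred X -> Y} := mem [set f : X -> Y | continuous f].
Arguments continuous_pred : simpl never.

Let continuous_Sub (f : X -> Y) (fP : f \in continuous_pred) :
  continuousType X Y := mkcts (set_mem fP).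

Let continuous_rect (P : continuousType X Y -> Type) :
  (forall f (fP : f \in continuous_pred), P (continuous_Sub fP)) ->
  forall f, P f.
Proof.
move=> PSub f.
have fP : (f : X -> Y) \in continuous_pred by apply/mem_set/cts_fun.
by rewrite (_ : f = continuous_Sub fP)//; exact/continuousEP.
Qed.

HB.instance Definition _ :=
  @isSub.Build _ _ (continuousType X Y) (@Continuous.sort X Y)
    continuous_Sub continuous_rect (fun _ _ => erefl).

Lemma continuous_submod_closed : submod_closed continuous_pred.
Proof.
split; first by apply/mem_set => x; exact: cvg_cst.
move=> a f g /set_mem cf /set_mem cg; apply/mem_set => x.
by apply: cvgD; [apply: cvgZ; [exact: cvg_cst|exact: cf]|exact: cg].
Qed.

HB.instance Definition _ := GRing.isSubmodClosed.Build _ _ continuous_pred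
  continuous_submod_closed.

HB.instance Definition _ :=
  [SubChoice_isSubLmodule of continuousType X Y by <:].

End continuous_lmodule.

Section hamel_dimension.
Context {K : fieldType} {E : lmodType K}.
Implicit Types B W : set E.

Definition lin_span B : set E :=
  [set v | exists (s : seq E) (c : E -> K),
     [set` s] `<=` B /\ v = \sum_(u <- s) c u *: u].

Definition lin_independent B : Prop :=
  forall (s : seq E) (c : E -> K), uniq s -> [set` s] `<=` B ->
    \sum_(u <- s) c u *: u = 0 -> forall u, u \in s -> c u = 0.

Definition hamel_basis W B : Prop := lin_independent B /\ lin_span B = W.

(* The dimension of W, as a cardinal, is that of the set A. *)
Definition has_dimension W {T : Type} (A : set T) : Prop :=
  exists B : set E, hamel_basis W B /\ B #= A.

End hamel_dimension.

Definition continuum_lineable {R : realType} {E : lmodType R} (S : set E) :=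
  exists W : set E, [/\ submod_closed (mem W), has_dimension W [set: R] &
    W `<=` S `|` [set 0]].

Definition continuous_surjections (R : realType) (m n : nat) :
    set (continuousType 'rV[R]_m 'rV[R]_n) :=
  [set f | set_surj [set: 'rV[R]_m] [set: 'rV[R]_n] f].
Arguments continuous_surjections : clear implicits.

(* Main.v *)
(* Compose a continuous surjection F : R -> R^n with the functions
   h_r(t) = t exp(e^r |t|) coordinatewise.  A nontrivial combination of the
   h_r is odd and continuous, and unbounded because the largest rate dominates at
   infinity; hence it is onto R.  Consequently every nontrivial
   combination of the maps h_r o F o (first coordinate) is onto R^n.

   F is a variant of Schoenberg's curve.  A 1-periodic continuous pulse reads the
   i-th octal digit of t off 8^i t, provided that all fractional digits are 0 or
   4; summing the pulses with weights 8^-i / 2 recovers the fractional part of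
   such a t, hence also its integer part K, while summing them along the residue
   classes modulo n with weights 2^-(k+1) gives arbitrary z in [0, 1]^n.  Then
   F(t) = K (2 z - 1), and K and z can be prescribed independently. *)
Require Import Defs.
From mathcomp Require Import all_boot all_order all_algebra.
From mathcomp Require Import all_classical all_reals all_analysis.
From mathcomp Require Import ring lra.
Import numFieldNormedType.Exports.
Import Order.TTheory GRing.Theory Num.Theory.

Set Implicit Arguments.
Unset Strict Implicit.
Unset Printing Implicit Defensive.

Local Open Scope classical_set_scope.
Local Open Scope ring_scope.

(** * Series dominated by a geometric series of ratio 1/2 *)

Section half_series.
Context {R : realType}.
Implicit Types q : nat -> R.

(** The exponent [k.+1] makes the tail from index [N] at most 2^-N; for a family of series this
    bound is uniform in the parameter. *)
Definition half_dominated q := forall k, `|q k| <= 2^-1 ^+ k.+1.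

Lemma half_dominated_cvg q : half_dominated q -> cvgn (series q).
Proof.
move=> qh; apply: normed_cvg.
apply: (@series_le_cvg _ _ (geometric 2^-1 2^-1)).
- by move=> k /=.
- by move=> k; rewrite /= -exprS exprn_ge0.
- by move=> k; rewrite /geometric /= -exprS; exact: qh.
- by apply: is_cvg_geometric_series; rewrite ger0_norm // invf_lt1 // ltr1n.
Qed.

Lemma half_dominated_tail q N : half_dominated q ->
  `|limn (series q) - series q N| <= 2^-1 ^+ N.
Proof.
move=> qh.
(* The subtracted 2^-(N+i) is what lets the induction on [i] close. *)
have H i : `|series q (N + i)%N - series q N| <= 2^-1 ^+ N - 2^-1 ^+ (N + i).
  elim: i => [|i IH]; first by rewrite addn0 !subrr normr0.
  rewrite addnS seriesSr; set s := series q (N + i)%N in IH *.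
  rewrite (_ : s + _ - _ = (s - series q N) + q (N + i)%N); last by ring.
  apply: le_trans (ler_normD _ _) _.
  have := qh (N + i)%N; rewrite exprS; lra.
have cq := half_dominated_cvg qh.
rewrite -[_ - _](_ : limn (fun k => series q k - series q N) = _); last first.
  by apply/cvg_lim => //; apply: cvgB => //; exact: cvg_cst.
rewrite -lim_norm; last by apply: is_cvgB => //; exact: is_cvg_cst.
apply: limr_le; first by apply: is_cvg_norm; apply: is_cvgB => //; exact: is_cvg_cst.
near=> k; have Nk : (N <= k)%N by near: k; exact: nbhs_infty_ge.
rewrite -(subnKC Nk); apply: le_trans (H _) _.
by rewrite gerBl exprn_ge0.
Unshelve. all: by end_near. Qed.

Lemma half_lim (e : R) : 0 < e -> exists N, 2^-1 ^+ N < e.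
Proof.
move=> e0; have : (fun n => 2^-1 ^+ n) @ \oo --> (0 : R).
  by apply: cvg_expr; rewrite ger0_norm // invf_lt1 // ltr1n.
move/cvgrPdist_lt => /(_ e e0) [N _ /(_ N (leqnn N))] /=.
by rewrite sub0r normrN ger0_norm ?exprn_ge0 // => ?; exists N.
Qed.

Lemma series_half_unique q (l : R) :
  (forall N, `|l - series q N| <= 2^-1 ^+ N) -> limn (series q) = l.
Proof.
move=> H; apply/cvg_lim => //; apply/cvgrPdist_lt => e e0.
have [N Ne] := half_lim e0; exists N => // n /= Nn.
apply: le_lt_trans (H n) (le_lt_trans _ Ne).
by rewrite ler_wiXn2l // ?invr_ge0 // invf_le1 // ler1n.
Qed.

Lemma series_shift q : cvgn (series (fun k => q k.+1)) ->
  limn (series q) = q 0 + limn (series (fun k => q k.+1)).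
Proof.
move=> cq; apply/cvg_lim => //; rewrite -cvg_shiftS.
rewrite (_ : (fun n => series q n.+1) =
  (fun n => q 0 + series (fun k => q k.+1) n)); last first.
  apply/funext => n; rewrite /series /=.
  by rewrite big_nat_recl.
by apply: cvgD => //; exact: cvg_cst.
Qed.

Lemma continuous_half_series (T : topologicalType) (q : nat -> T -> R) :
  (forall k, continuous (q k)) -> (forall x, half_dominated (q ^~ x)) ->
  continuous (fun x => limn (series (q ^~ x))).
Proof.
move=> qc qh x; apply/cvgrPdist_lt => e e0.
have [N Ne] : exists N, 2^-1 ^+ N < e / 3 by apply: half_lim; lra.
have sc : {for x, continuous (fun y => series (q ^~ y) N)}.
  rewrite /series /=; elim: N {Ne} => [|N IH].
    rewrite (_ : (fun y => _) = cst 0); first exact: cvg_cst.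
    by apply/funext => y; rewrite big_geq.
  rewrite (_ : (fun y => _) = (fun y => \sum_(0 <= k < N) q k y + q N y)).
    by apply: cvgD => //; exact: qc.
  by apply/funext => y; rewrite big_nat_recr.
have e3 : 0 < e / 3 by lra.
move/cvgrPdist_lt: sc => /(_ _ e3); apply: filterS => y /= xy.
have := half_dominated_tail N (qh x); have := half_dominated_tail N (qh y).
move: xy Ne; set a := limn _; set b := limn _.
rewrite !ltr_norml !ler_norml; move=> /andP[? ?] ? /andP[? ?] /andP[? ?].
apply/andP; split; lra.
Qed.

Lemma binary_expansion (z : R) : 0 <= z <= 1 -> exists b : nat -> bool,
  limn (series (fun k => 2^-1 ^+ k.+1 * (b k)%:R : R)) = z.
Proof.
(* Greedy remainders: double, and subtract 1 from 1/2 on. They stay in [0, 1], and 2^-N times the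
   [N]-th is the error after [N] digits. *)
move=> z01; pose r := fix r k : R := if k is k'.+1 then
  2 * r k' - (2^-1 <= r k')%R%:R else z.
pose b k := 2^-1 <= r k.
exists b; apply: series_half_unique => N.
have rN : 0 <= r N <= 1.
  elim: N => //= N /andP[r0 r1]; case: (leP _ (r N)) => /= ?; lra.
rewrite (_ : z - _ = 2^-1 ^+ N * r N).
  rewrite normrM ger0_norm ?exprn_ge0 //; case/andP: rN => r0 r1.
  by rewrite ger0_norm // ler_piMr // exprn_ge0.
elim: N {rN} => [|N IH].
  by rewrite /series /= big_geq // subr0 expr0 mul1r.
rewrite seriesSr opprD addrA IH /= exprS -/(b N); by field.
Qed.

End half_series.

(** * Reading octal digits 0 and 4 with a periodic pulse *)

Section digits.
Context {R : realType}.
Implicit Types (t s x : R) (b : nat -> bool).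

(* The retraction of the line onto [0, 1], in a form whose continuity is that of
   the norm. *)
Definition clamp x : R := (`|x| - `|x - 1| + 1) / 2.

(** Equal to 0 within 1/6 of the integers and to 1 within 1/6 of the half-integers. *)
Definition pulse t : R := clamp (2^-1 - cos (pi *+ 2 * t)).

Lemma clamp_itv x : 0 <= clamp x <= 1.
Proof. by rewrite /clamp; case: (ger0P x) => ?; case: (ger0P (x - 1)) => ?; lra. Qed.

Lemma clamp_le0 x : x <= 0 -> clamp x = 0.
Proof. by move=> ?; rewrite /clamp; case: (ger0P x) => ?; case: (ger0P (x - 1)) => ?; lra. Qed.

Lemma clamp_ge1 x : 1 <= x -> clamp x = 1.
Proof. by move=> ?; rewrite /clamp; case: (ger0P x) => ?; case: (ger0P (x - 1)) => ?; lra. Qed.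

Lemma continuous_clamp : continuous clamp.
Proof.
move=> x; apply: cvgMr_tmp; apply: cvgD; last exact: cvg_cst.
by apply: cvgB; apply: cvg_norm => //; apply: cvgB => //; exact: cvg_cst.
Qed.

Lemma continuous_pulse : continuous pulse.
Proof.
move=> t; apply: (@continuous_comp _ _ _ (fun s => 2^-1 - cos (pi *+ 2 * s)) clamp).
  apply: cvgB; first exact: cvg_cst.
  apply: (@continuous_comp _ _ _ (fun s => pi *+ 2 * s) cos).
    by apply: cvgMl_tmp.
  exact: continuous_cos.
exact: continuous_clamp.
Qed.

Lemma pulse_periodic t (k : nat) : pulse (t + k%:R) = pulse t.
Proof.
by rewrite /pulse mulrDr mulr_natr (periodicn (@cosD2pi R)).
Qed.

(** The double angle stays in the first quadrant, so 2 cos^2 x - 1 >= 0, which excludes 0 <= cos x <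
    1/2. *)
Lemma cos_ge_half x : 0 <= x <= pi / 4 -> 2^-1 <= cos x.
Proof.
move=> /andP[x0 x4]; have p0 := pi_gt0 R.
have c0 : 0 <= cos x by apply: cos_ge0_pihalf; apply/andP; split; lra.
have : 0 <= cos (x *+ 2).
  by apply: cos_ge0_pihalf; rewrite (mulr2n x); apply/andP; split; lra.
rewrite cos_mulr2n (mulr2n (cos x ^+ 2)) => H; rewrite leNgt; apply/negP => c1.
have : cos x ^+ 2 <= 2^-1 * 2^-1 by rewrite expr2 ler_pM // ltW.
lra.
Qed.

Lemma pulse_digit (d : bool) s : 0 <= s <= 8^-1 -> pulse (d%:R / 2 + s) = d%:R.
Proof.
move=> /andP[s0 s8]; have p0 := pi_gt0 R.
have /cos_ge_half c : 0 <= pi *+ 2 * s <= pi / 4.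
  have : 0 <= pi * s by rewrite mulr_ge0 // ltW.
  have : pi * s <= pi * 8^-1 by rewrite ler_pM2l.
  rewrite -mulr_natr; lra.
rewrite /pulse; case: d => /=.
  rewrite mulrDr (_ : pi *+ 2 * (1 / 2) = pi); last by rewrite (mulr2n pi); field.
  by rewrite (addrC pi) cosDpi clamp_ge1 //; lra.
by rewrite mul0r add0r clamp_le0 //; lra.
Qed.

(* The number with octal digits 4 b_i, 4 b_(i+1), ... after the point: these
   digits leave the gap that [pulse] needs to read off b_i continuously. *)
Definition address b (i : nat) : R :=
  limn (series (fun k => 8^-1 ^+ k / 2 * (b (i + k)%N)%:R : R)).

Lemma eighths_half_dominated (u : nat -> R) : (forall k, 0 <= u k <= 1) ->
  half_dominated (fun k => 8^-1 ^+ k / 2 * u k).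
Proof.
move=> u01 k; have /andP[u0 u1] := u01 k.
have e0 : (0 : R) <= 8^-1 ^+ k by rewrite exprn_ge0.
rewrite ger0_norm; last by rewrite !mulr_ge0.
rewrite exprSr; apply: (@le_trans _ _ (8^-1 ^+ k / 2)).
  by rewrite ler_piMr // mulr_ge0.
rewrite ler_wpM2r // lerXn2r // ?nnegrE //; lra.
Qed.

Lemma address_half_dominated b i :
  half_dominated (fun k => 8^-1 ^+ k / 2 * (b (i + k)%N)%:R : R).
Proof. by apply: eighths_half_dominated => k; case: (b _); rewrite /= ?lexx ler01. Qed.

Lemma address_itv b i : 0 <= address b i <= 1.
Proof.
have d := address_half_dominated b i; apply/andP; split.
  apply: limr_ge; first exact: half_dominated_cvg.
  by apply: nearW => n; apply: sumr_ge0 => k _; rewrite !mulr_ge0.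
have := half_dominated_tail 0 d; rewrite expr0 -/(address b i) => H.
by apply: le_trans (ler_norm _) _; move: H; rewrite /series /= big_geq // subr0.
Qed.

Lemma address_rec b i : address b i = (b i)%:R / 2 + address b i.+1 / 8.
Proof.
have c : cvgn (series (fun k => 8^-1 ^+ k / 2 * (b (i.+1 + k)%N)%:R : R)).
  exact/half_dominated_cvg/address_half_dominated.
pose q k : R := 8^-1 ^+ k / 2 * (b (i + k)%N)%:R.
have E : (fun k => q k.+1) =
    8^-1 *: (fun k => 8^-1 ^+ k / 2 * (b (i.+1 + k)%N)%:R : R).
  apply/funext => k; rewrite /q addnS -addSn exprS.
  transitivity (8^-1 * (8^-1 ^+ k / 2 * (b (i.+1 + k)%N)%:R) : R) => //.
  by rewrite !mulrA.
rewrite /address -/q series_shift E; last exact: is_cvg_seriesZ.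
rewrite lim_seriesZ // /q addn0 expr0 -/(address b i.+1).
by congr (_ + _); [field|rewrite /GRing.scale /= mulrC].
Qed.

(** Multiplying by 8^i moves the octal point past [i] digits; what lies before it is an integer,
    invisible to the periodic pulse. The rest is [b i] / 2 plus at most 1/8. *)
Lemma pulse_address b (K i : nat) :
  pulse (8 ^+ i * (K%:R + address b 0)) = (b i)%:R.
Proof.
have [N ->] : exists N : nat, 8 ^+ i * (K%:R + address b 0) = address b i + N%:R.
  elim: i => [|i [N IH]]; first by exists K; rewrite expr0 mul1r addrC.
  exists (8 * N + 4 * b i)%N.
  rewrite exprS -mulrA IH address_rec natrD !natrM; by field.
rewrite pulse_periodic address_rec pulse_digit //.
by have := address_itv b i.+1; lra.
Qed.

End digits.

(** * A continuous curve filling the whole space *)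

Section curve.
Context {R : realType} (n : nat).

(* An integer part only at the points K + address b 0. *)
Definition integer_part_curve (t : R) : R :=
  t - limn (series (fun k => 8^-1 ^+ k / 2 * pulse (8 ^+ k * t))).

(* Reads off the digits in positions congruent to j modulo n as a binary
   expansion. *)
Definition cube_curve (j : 'I_n) (t : R) : R :=
  limn (series (fun k => 2^-1 ^+ k.+1 * pulse (8 ^+ (k * n + j) * t))).

Definition space_curve (j : 'I_n) (t : R) : R :=
  integer_part_curve t * (2 * cube_curve j t - 1).

Lemma continuous_pulse_scale (c a : R) : continuous (fun t => c * pulse (a * t)).
Proof.
move=> t; apply: cvgMl_tmp.
apply: (@continuous_comp _ _ _ (fun t => a * t) pulse).
  by apply: cvgMl_tmp.
exact: continuous_pulse.
Qed.

Lemma continuous_space_curve j : continuous (space_curve j).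
Proof.
have ci : continuous integer_part_curve.
  move=> t; apply: cvgB => //; apply: continuous_half_series => [k|s].
    exact: continuous_pulse_scale.
  by apply: eighths_half_dominated => k; exact: clamp_itv.
have cc : continuous (cube_curve j).
  apply: continuous_half_series => [k|s k]; first exact: continuous_pulse_scale.
  have /andP[p0 p1] := clamp_itv (2^-1 - cos (pi *+ 2 * (8 ^+ (k * n + j) * s))).
  rewrite ger0_norm; last by rewrite mulr_ge0 // exprn_ge0.
  by rewrite ler_piMr // exprn_ge0.
move=> t; apply: cvgM; first exact: ci.
by apply: cvgB; [apply: cvgMl_tmp; exact: cc|exact: cvg_cst].
Qed.

Lemma space_curve_surj (y : 'I_n -> R) : exists t, forall j, space_curve j t = y j.
Proof.
(* One bound for all coordinates, positive so that [y j] / [K] lies in [-1, 1] and can be encoded in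
   [0, 1]. *)
have [K [K0 yK]] : exists K : nat, 0 < K%:R :> R /\ forall j, `|y j| <= K%:R.
  exists (Num.bound (\sum_j `|y j|)).+1; split; first by rewrite ltr0n.
  move=> j; apply: (@le_trans _ _ (\sum_j `|y j|)).
    by rewrite (bigD1 j) //= lerDl sumr_ge0.
  apply: ltW; apply: lt_le_trans (archi_boundP _) _; first exact: sumr_ge0.
  by rewrite ler_nat.
have /choice[B BP] : forall j : 'I_n, exists b : nat -> bool,
    limn (series (fun k => 2^-1 ^+ k.+1 * (b k)%:R : R)) = (1 + y j / K%:R) / 2.
  move=> j; apply: binary_expansion.
  have : `|y j / K%:R| <= 1.
    by rewrite normrM normfV (gtr0_norm K0) ler_pdivrMr // mul1r.
  rewrite ler_norml; lra.
(* Interleaves the [n] digit sequences; the default [false] is reached only when [n] = 0. *)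
pose b i := if insub (i %% n)%N is Some j then B j (i %/ n)%N else false.
have bE (j : 'I_n) k : b (k * n + j)%N = B j k.
  have n0 : (0 < n)%N by case: j => j; apply: leq_ltn_trans.
  rewrite /b modnMDl divnMDl // modn_small // divn_small // addn0.
  by rewrite valK.
exists (K%:R + address b 0) => j.
rewrite /space_curve /integer_part_curve /cube_curve.
set t := K%:R + address b 0.
have -> : (fun k => 8^-1 ^+ k / 2 * pulse (8 ^+ k * t)) =
    (fun k => 8^-1 ^+ k / 2 * (b k)%:R).
  by apply/funext => k; rewrite pulse_address.
have -> : (fun k => 2^-1 ^+ k.+1 * pulse (8 ^+ (k * n + j) * t)) =
    (fun k => 2^-1 ^+ k.+1 * (B j k)%:R).
  by apply/funext => k; rewrite pulse_address bE.
rewrite BP -/(address b 0) /t; field.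
exact: lt0r_neq0.
Qed.

End curve.

(** * Combinations of odd functions of exponential growth *)

Section growth.
Context {R : realType}.
Implicit Types (r t : R) (a : R -> R) (s : seq R).

(* The inner expR only turns the index r into a positive rate. *)
Definition growth r t : R := t * expR (expR r * `|t|).

Lemma continuous_growth r : continuous (growth r).
Proof.
move=> t; apply: cvgM => //.
apply: (@continuous_comp _ _ _ (fun t => expR r * `|t|) expR).
  by apply: cvgMl_tmp; exact: cvg_norm.
exact: continuous_expR.
Qed.

Lemma growthN r t : growth r (- t) = - growth r t.
Proof. by rewrite /growth normrN mulNr. Qed.

Lemma cvgy_expR_decay (d : R) : 0 < d -> expR (- d * t) @[t --> +oo] --> (0 : R).
Proof.
move=> d0; rewrite (_ : (fun t => _) = (fun t => expR (- t)) \o (fun t => d * t)).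
  apply: (@cvg_comp _ _ _ _ _ _ (pinfty_nbhs R)); last exact: cvgr_expR.
  apply/cvgryPge => A.
  apply: filterS (nbhs_pinfty_ge (num_real (d^-1 * A))) => t.
  by rewrite ler_pdivrMl.
by apply/funext => t /=; rewrite mulNr.
Qed.

Lemma has_max (P : pred R) s : has P s ->
  exists2 r0, r0 \in s /\ P r0 & forall r, r \in s -> P r -> r <= r0.
Proof.
elim: s => //= x s IH; case: (boolP (has P s)) => [hs _|hs].
  have [r0 [r0s Pr0] r0P] := IH hs.
  have [/andP[Px r0x]|xP] := boolP (P x && (r0 <= x)).
    exists x; first by rewrite mem_head.
    move=> r; rewrite inE => /predU1P[->//|rs Pr].
    exact: le_trans (r0P _ rs Pr) r0x.
  exists r0; first by rewrite inE r0s orbT.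
  move=> r; rewrite inE => /predU1P[-> Px|]; last exact: r0P.
  by move: xP; rewrite Px /= -ltNge => /ltW.
rewrite orbF => Px; exists x; first by rewrite mem_head.
move=> r; rewrite inE => /predU1P[->//|rs Pr].
by case/hasP: hs; exists r.
Qed.

Lemma growth_combination_large s a : uniq s -> (exists2 r, r \in s & a r != 0) ->
  forall M : R, exists2 t, 0 <= t & M <= `|\sum_(r <- s) a r * growth r t|.
Proof.
move=> us [r1 r1s ar1] M.
have [|r0 [r0s ar0] r0P] := @has_max (fun r => a r != 0) s.
  by apply/hasP; exists r1.
(* The combination with its dominant factor t exp(e^r0 t) divided out: only the term of [r0]
   survives at infinity. *)
pose f t := \sum_(r <- s) a r * expR (- (expR r0 - expR r) * t).
have fE t : 0 <= t ->
    \sum_(r <- s) a r * growth r t = t * expR (expR r0 * t) * f t.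
  move=> t0; rewrite /f mulr_sumr; apply: eq_bigr => r _.
  rewrite /growth ger0_norm //.
  rewrite (_ : expR r * t = expR r0 * t + - (expR r0 - expR r) * t); last by ring.
  by rewrite expRD; ring.
have cf : f t @[t --> +oo] --> a r0.
  rewrite -[X in _ --> X](_ : \sum_(r <- s) (if r == r0 then a r else 0) = _).
    rewrite big_seq /f; under eq_cvg do rewrite big_seq.
    apply: cvg_big => [|r rs]; first exact: add_continuous.
    have [->|rr0] := eqVneq r r0.
      rewrite subrr oppr0; under eq_fun do rewrite mul0r expR0 mulr1.
      exact: cvg_cst.
    (* Indices above [r0] give growing exponentials, but their coefficients vanish. *)
    have [->|ar] := eqVneq (a r) 0.
      by under eq_fun do rewrite mul0r; exact: cvg_cst.
    rewrite -(mulr0 (a r)); apply: cvgMl_tmp; apply: cvgy_expR_decay.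
    by rewrite subr_gt0 ltr_expR lt_neqAle rr0 r0P.
  by rewrite -big_mkcond -big_filter filter_pred1_uniq // big_seq1.
have a0 : 0 < `|a r0| by rewrite normr_gt0.
have a2 : 0 < `|a r0| / 2 by lra.
(* Once [f t] is at least half of [a r0] in absolute value and the exponential is at least 1, the
   factor [t] alone must reach [M]. *)
have : \forall t \near +oo, [/\ `|a r0 - f t| < `|a r0| / 2, 0 <= t &
    `|M| / (`|a r0| / 2) <= t].
  near=> t; split.
  - by near: t; move/cvgrPdist_lt: cf; apply.
  - by near: t; apply: nbhs_pinfty_ge; exact: num_real.
  - by near: t; apply: nbhs_pinfty_ge; exact: num_real.
case/filter_ex => t [ft t0 tM]; exists t => //.
rewrite fE // !normrM (ger0_norm t0) ger0_norm ?expR_ge0 //.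
have e1 : 1 <= expR (expR r0 * t).
  by apply: le_trans (expR_ge1Dx _); rewrite lerDl mulr_ge0 // expR_ge0.
have f2 : `|a r0| / 2 <= `|f t|.
  have := ler_normD (a r0 - f t) (f t); rewrite subrK; lra.
apply: le_trans (ler_norm M) _.
rewrite ler_pdivrMr // in tM; apply: le_trans tM _.
by apply: ler_pM => //; rewrite ler_peMr.
Unshelve. all: by end_near. Qed.

Lemma growth_combination_surj s a : uniq s -> (exists2 r, r \in s & a r != 0) ->
  forall y : R, exists t, \sum_(r <- s) a r * growth r t = y.
Proof.
move=> us as0 y; pose h t := \sum_(r <- s) a r * growth r t.
have hc : continuous h.
  move=> t; apply: cvg_big => [|r _]; first exact: add_continuous.
  by apply: cvgMl_tmp; exact: continuous_growth.
have hN t : h (- t) = - h t.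
  by rewrite /h -sumrN; apply: eq_bigr => r _; rewrite growthN mulrN.
have [T T0 yT] := growth_combination_large us as0 `|y|.
(* By oddness [h] takes opposite values at -T and T, of absolute value at least that of [y], so [y]
   lies between them. *)
suff [t _ <-] : exists2 t, t \in `[- T, T] & h t = y by exists t.
apply: IVT; [lra|exact: continuous_subspaceT|].
rewrite hN ge_min le_max; move: yT; rewrite -/(h T).
case: (ger0P (h T)) => _; rewrite ler_norml => /andP[? ?].
  by apply/andP; split; apply/orP; [left|right]; lra.
by apply/andP; split; apply/orP; [right|left]; lra.
Qed.

End growth.

(** * Linear spans and families indexed by the reals *)

Section lineability.
Context {K : fieldType} {E : lmodType K}.
Implicit Types (s : seq E) (c : E -> K) (B : set E).

(** Lists in [lin_span] may repeat vectors. Moving multiplicities into the coefficients puts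
    combinations over a common duplicate-free list. *)
Lemma sum_count_mem s s' c : {subset s <= s'} -> uniq s' ->
  \sum_(u <- s) c u *: u = \sum_(u <- s') (c u *+ count_mem u s) *: u.
Proof.
move=> + us'; elim: s => [_|x s IH ss'].
  by rewrite big_nil big1 // => u _; rewrite /= mulr0n scale0r.
have xs' : x \in s' by apply: ss'; rewrite mem_head.
rewrite big_cons IH => [|u us]; last by apply: ss'; rewrite inE us orbT.
rewrite [RHS](bigD1_seq x) //= [in LHS](bigD1_seq x) //= eqxx mulrnDr scalerDl.
rewrite -addrA; congr (_ + (_ + _)); apply: eq_bigr => u.
by rewrite eq_sym => /negPf->.
Qed.

Lemma lin_span_submod_closed B : submod_closed (mem (lin_span B)).
Proof.
split.
  by apply/mem_set; exists [::], (fun=> 0); split => //; rewrite big_nil.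
move=> a u v /set_mem[s [c [sB ->]]] /set_mem[s' [c' [sB' ->]]].
pose w := undup (s ++ s'); have uw : uniq w := undup_uniq _.
apply/mem_set; exists w; exists (fun x =>
  a * (c x *+ count_mem x s) + c' x *+ count_mem x s'); split.
  by move=> x /=; rewrite mem_undup mem_cat => /orP[/sB|/sB'].
rewrite (@sum_count_mem s w) // => [|x xs]; last by rewrite mem_undup mem_cat xs.
rewrite (@sum_count_mem s' w) // => [|x xs]; last by rewrite mem_undup mem_cat xs orbT.
rewrite scaler_sumr -big_split /=; apply: eq_bigr => x _.
by rewrite scalerDl scalerA.
Qed.

End lineability.

(* A family indexed by the reals, all of whose nontrivial combinations lie in S,
   is automatically injective and independent because 0 is not in S. *)
Lemma continuum_lineable_family (R : realType) (E : lmodType R) (S : set E)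
    (G : R -> E) : ~ S 0 ->
  (forall (s : seq R) (a : R -> R), uniq s -> (exists2 r, r \in s & a r != 0) ->
    S (\sum_(r <- s) a r *: G r)) ->
  continuum_lineable S.
Proof.
move=> S0 SG.
have Ginj : injective G.
  move=> r r' rr'; apply/eqP; apply: contraT => neq; exfalso; apply: S0.
  (* If [G r] = [G r'] with distinct indices, their difference is a nontrivial combination equal to
     0. *)
  rewrite [X in S X](_ : _ = \sum_(x <- [:: r; r']) (if x == r then 1 else -1) *: G x).
    apply: SG; first by rewrite /= inE neq.
    by exists r; rewrite ?mem_head // eqxx oner_neq0.
  by rewrite big_cons big_seq1 eqxx eq_sym (negPf neq) rr' scale1r scaleN1r subrr.
have rangeP (s : seq E) : [set` s] `<=` range G -> exists rs, s = map G rs.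
  elim: s => [_|x s IH sG]; first by exists [::].
  have [r _ rx] : range G x by apply: sG; rewrite /= mem_head.
  have [|rs ->] := IH; last by exists (r :: rs); rewrite /= rx.
  by move=> u us; apply: sG; rewrite /= inE us orbT.
(* Pulled back along [G], the combination is either trivial or in [S]. This yields both independence
   and the inclusion of the span. *)
have key (s : seq E) c : uniq s -> [set` s] `<=` range G ->
    (forall u, u \in s -> c u = 0) \/ S (\sum_(u <- s) c u *: u).
  move=> /[swap] /rangeP[rs ->]; rewrite map_inj_uniq // big_map => us.
  have [/hasP[r rs0 cr]|/hasPn c0] := boolP (has (fun r => c (G r) != 0) rs).
    by right; apply: SG => //; exists r.
  left => _ /mapP[r rrs ->]; apply/eqP.
  by have := c0 _ rrs; rewrite negbK.
exists (lin_span (range G)); split.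
- exact: lin_span_submod_closed.
- exists (range G); split; last by apply: inj_card_eq; apply: in2W.
  split => // s c us sG s0; have [//|] := key s c us sG.
  by rewrite s0.
- move=> _ [s [c [sG ->]]].
  rewrite (@sum_count_mem _ _ s (undup s)) ?undup_uniq // => [|u]; last first.
    by rewrite mem_undup.
  have [||c0|] := key (undup s) (fun u => c u *+ count_mem u s).
  + exact: undup_uniq.
  + by move=> u /=; rewrite mem_undup; exact: sG.
  + by right; apply: big1_seq => u /= us; rewrite c0 // scale0r.
  + by left.
Qed.

(** * Assembling the family of surjections *)

Lemma continuous_row (R : realType) (T : topologicalType) (n : nat)
    (f : 'I_n -> T -> R) : (forall j, continuous (f j)) ->
  continuous (fun x => \row_j f j x : 'rV[R]_n).
Proof.
move=> fc x; apply/cvg_mx_entourageP => A eA.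
have H : \forall y \near x, forall j, A (f j x, f j y).
  by apply: filter_forall => j; have /cvg_entourageP/(_ A eA) := fc j x.
by apply: filterS H => y xy i j; rewrite !mxE inE.
Qed.

Theorem theorem2p5 (R : realType) (m n : nat) (hm : (0 < m)%N) (hn : (0 < n)%N) :
  continuum_lineable (continuous_surjections R m n).
Proof.
pose i0 : 'I_m := Ordinal hm; pose j0 : 'I_n := Ordinal hn.
pose g r (x : 'rV[R]_m) : 'rV[R]_n := \row_j growth r (space_curve j (x ord0 i0)).
have gc r : continuous (g r).
  apply: continuous_row => j x.
  apply: (@continuous_comp _ _ _ (fun x : 'rV[R]_m => space_curve j (x ord0 i0))
    (growth r)); last exact: continuous_growth.
  apply: (@continuous_comp _ _ _ (fun x : 'rV[R]_m => x ord0 i0) (space_curve j)).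
    exact: coord_continuous.
  exact: continuous_space_curve.
pose G r : continuousType 'rV[R]_m 'rV[R]_n := mkcts (gc r).
(* The zero map misses the all-ones row, as there is a coordinate [j0]. *)
apply: (@continuum_lineable_family _ _ _ G) => [/(_ (const_mx 1) I)[x _]|s a us as0 y _].
  move/rowP/(_ j0); rewrite !mxE => /esym/eqP; by rewrite oner_eq0.
(* Each coordinate is solved separately; the curve then meets all the solutions [t j] at a single
   parameter [p]. *)
have /choice[t tP] (j : 'I_n) : exists t, \sum_(r <- s) a r * growth r t = y ord0 j.
  exact: growth_combination_surj.
have [p pt] := space_curve_surj t.
exists (const_mx p) => //.
have -> : (\sum_(r <- s) a r *: G r : 'rV_m -> 'rV_n) (const_mx p) =
    \sum_(r <- s) a r *: g r (const_mx p).
  transitivity (val (\sum_(r <- s) a r *: G r) (const_mx p)) => //.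
  rewrite raddf_sum fct_sumE.
  by apply: eq_bigr.
apply/rowP => j; rewrite summxE -tP; apply: eq_bigr => r _.
by rewrite !mxE pt.
Qed.
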